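(* If $X$ is a connected weighted unicyclic graph whose cycle $C_p$ (with the weights inherited from $X$) has nonsingular subdivision $S(C_p)$, then no vertex of $S(X)$ is sedentary. In particular, if $X$ is a connected unweighted non-bipartite unicyclic graph, then no vertex of $S(X)$ is sedentary.
   Context: Graphs are simple, undirected, with nonzero real edge weights; $A(\cdot)$ is the weighted adjacency matrix; unweighted means all weights are $1$; nonsingular means the adjacency matrix is invertible. The subdivision $S(X)$ replaces each edge $\{u,v\}$ of weight $\omega$ by a new vertex $w$ and edges $\{u,w\},\{w,v\}$ of weight $\omega$. With $U(t)=e^{itA}$, a vertex $u$ is sedentary if $\inf_{t>0}|U(t)_{u,u}|\ge C$ for some $0<C\le1$, and not sedentary if the infimum is $0$. *)

(* Defs.v *)
From HB Require Import structures.
From mathcomp Require Import all_boot all_order all_algebra.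
From mathcomp Require Import all_classical all_reals all_analysis.
Set Implicit Arguments. Unset Strict Implicit. Unset Printing Implicit Defensive.
Import Order.TTheory GRing.Theory Num.Theory.
Import numFieldNormedType.Exports.
Local Open Scope ring_scope.

Section Defs.
Variable R : realType.

(* A weighted simple graph on vertex set 'I_n is given by its weighted
   adjacency matrix A: symmetric, zero diagonal; {i,j} is an edge of weight
   A i j iff A i j != 0. *)
Definition simple_weighted {n} (A : 'M[R]_n) : Prop :=
  A^T = A /\ forall i, A i i = 0.

Definition unweighted {n} (A : 'M[R]_n) : Prop :=
  forall i j, A i j = 0 \/ A i j = 1.

Definition adj {n} (A : 'M[R]_n) : rel 'I_n := fun i j => A i j != 0.

Definition connected_graph {n} (A : 'M[R]_n) : Prop :=
  forall i j, connect (adj A) i j.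

Definition bipartite {n} (A : 'M[R]_n) : Prop :=
  exists f : 'I_n -> bool, forall i j, A i j != 0 -> f i != f j.

Definition is_cycle {n p} (A : 'M[R]_n) (c : 'I_p -> 'I_n) : Prop :=
  (3 <= p)%N /\ injective c /\ forall i : 'I_p, A (c i) (c (ordS i)) != 0.

Definition cycle_edges {n p} (c : 'I_p -> 'I_n) : {set {set 'I_n}} :=
  [set [set c i; c (ordS i)] | i : 'I_p].

Definition unicyclic {n} (A : 'M[R]_n) : Prop :=
  connected_graph A /\
  exists p (c : 'I_p -> 'I_n), is_cycle A c /\
    forall p' (c' : 'I_p' -> 'I_n), is_cycle A c' -> cycle_edges c' = cycle_edges c.

Definition cycle_mx {n p} (A : 'M[R]_n) (c : 'I_p -> 'I_n) : 'M[R]_p :=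
  \matrix_(i, j) (if (j == ordS i) || (i == ordS j) then A (c i) (c j) else 0).

Definition edge_pred {n} (A : 'M[R]_n) : pred ('I_n * 'I_n) :=
  fun e => (e.1 < e.2)%N && (A e.1 e.2 != 0).

Definition nedges {n} (A : 'M[R]_n) : nat := #|edge_pred A|.

Definition winc {n} (A : 'M[R]_n) : 'M[R]_(n, nedges A) :=
  \matrix_(v, k) (let e := enum_val k in
                  if (v == e.1) || (v == e.2) then A e.1 e.2 else 0).

(* adjacency matrix of the subdivision S(X): vertices 'I_n (old) followed by
   one new vertex per edge; edge {u,v} of weight w is replaced by {u,w_e},
   {w_e,v}, both of weight w. *)
Definition subdiv {n} (A : 'M[R]_n) : 'M[R]_(n + nedges A) :=
  block_mx 0 (winc A) (winc A)^T 0.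

(* U(t) = exp(i t M) = cos(tM) + i sin(tM), M real: real and imaginary
   parts of the entry (u,v), as the (real) power series of exp(itM). *)
Definition Ure {N} (M : 'M[R]_N) (t : R) (u v : 'I_N) : R :=
  limn ([series (-1) ^+ k * t ^+ (2 * k) / ((2 * k)`!)%:R
                      * (M ^+ (2 * k)) u v]_k : R^nat).

Definition Uim {N} (M : 'M[R]_N) (t : R) (u v : 'I_N) : R :=
  limn ([series (-1) ^+ k * t ^+ (2 * k + 1) / ((2 * k + 1)`!)%:R
                      * (M ^+ (2 * k + 1)) u v]_k : R^nat).

Definition Uabs {N} (M : 'M[R]_N) (t : R) (u v : 'I_N) : R :=
  Num.sqrt (Ure M t u v ^+ 2 + Uim M t u v ^+ 2).

Definition sedentary {N} (M : 'M[R]_N) (u : 'I_N) : Prop :=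
  exists C : R, 0 < C <= 1 /\ forall t : R, 0 < t -> C <= Uabs M t u u.

Definition not_sedentary {N} (M : 'M[R]_N) (u : 'I_N) : Prop :=
  forall e : R, 0 < e -> exists t : R, 0 < t /\ Uabs M t u u < e.

End Defs.

(* Main.v *)
(* The diagonal entry of exp(itM) at u has real part c(t) = cos(tM)_{uu}, and
   its imaginary part vanishes when M is the adjacency matrix of a bipartite
   graph.  If M is nonsingular then c is the derivative of the bounded function
   (sin(tM) M^-1)_{uu}, so c cannot stay away from 0: by continuity and c(0) = 1
   it would stay above some e > 0, and its primitive would be unbounded.

   S(X) is nonsingular when the unsigned incidence matrix of X is square and has
   trivial left kernel.  A connected unicyclic graph has at most as many edges as
   vertices; a kernel vector x satisfies x_i = - x_j along every edge, so |x| is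
   constant, and x = 0 if it vanishes on the cycle or if X is not bipartite. *)

Require Import Defs.
From HB Require Import structures.
From mathcomp Require Import all_boot all_order all_algebra.
From mathcomp Require Import all_classical all_reals all_analysis.
Import Order.TTheory GRing.Theory Num.Theory.
Import numFieldNormedType.Exports.
Local Open Scope ring_scope.
Set Implicit Arguments. Unset Strict Implicit. Unset Printing Implicit Defensive.

(** * Transition matrices of nonsingular matrices *)

Section MatrixSeries.
Variables (R : realType) (N : nat) (M : 'M[R]_N).

Let K : R := \sum_i \sum_j `|M i j|.

Let K_ge0 : 0 <= K.
Proof. by do 2!apply: sumr_ge0 => ? _. Qed.

(** [K] dominates every absolute row sum of [M], so each further factor [M] costs at most a factor
    [K]. *)
Lemma exprmx_entry_le k u v : `|(M ^+ k) u v| <= K ^+ k.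
Proof.
elim: k u v => [|k IH] u v.
  by rewrite !expr0 mxE; case: eqP => _; rewrite ?normr1 ?normr0 ?ler01.
rewrite !exprS mxE (le_trans (ler_norm_sum _ _ _)) //.
apply: (@le_trans _ _ ((\sum_j `|M u j|) * K ^+ k)).
  rewrite mulr_suml ler_sum // => w _.
  by rewrite normrM ler_wpM2l.
rewrite ler_wpM2r ?exprn_ge0 // /K [leRHS](bigD1 u) //= lerDl.
by do 2!apply: sumr_ge0 => ? _.
Qed.

Lemma is_cvg_pseries_expn_bound (f : R^nat) (L c x : R) :
  0 <= L -> 0 <= c -> (forall k, `|f k| <= L * c ^+ k / k`!%:R) -> cvgn (pseries f x).
Proof.
move=> L0 c0 fL; apply: normed_cvg.
apply: (@series_le_cvg _ _ (L *: exp_coeff (c * `|x|))).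
- by move=> k; rewrite normr_ge0.
- move=> k; rewrite /= mulr_ge0 // /exp_coeff /= divr_ge0 //.
  by rewrite exprn_ge0 // mulr_ge0.
- move=> k; rewrite [leLHS](_ : _ = `|f k| * `|x| ^+ k); last by rewrite /= normrM normrX.
  rewrite [leRHS](_ : _ = L * ((c * `|x|) ^+ k / k`!%:R)) // exprMn.
  rewrite (le_trans (ler_wpM2r _ (fL k))) ?exprn_ge0 //.
  by rewrite -!mulrA [X in c ^+ k * X]mulrC.
- by apply: is_cvg_seriesZ; exact: is_cvg_series_exp_coeff.
Qed.

(** With [b] the Taylor coefficients of f, this is the entry (u, v) of f(xM). *)
Definition mxseries (b : R^nat) (u v : 'I_N) (x : R) : R :=
  limn (pseries (fun k => b k * (M ^+ k) u v) x).

Lemma is_cvg_mxseries (b : R^nat) u v x :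
  (forall k, `|b k| <= k`!%:R^-1) ->
  cvgn (pseries (fun k => b k * (M ^+ k) u v) x).
Proof.
move=> bk; apply: (@is_cvg_pseries_expn_bound _ 1 K) => // k.
by rewrite normrM mul1r mulrC ler_pM // exprmx_entry_le.
Qed.

(** Termwise differentiation gives f'(xM) M; the sum over [w] comes from splitting off the last
    factor of M^(k+1). *)
Lemma is_derive_mxseries (b : R^nat) u v (x : R) :
  (forall k, `|b k| <= k`!%:R^-1) ->
  is_derive x (1 : R) (mxseries b u v)
    (\sum_w mxseries (pseries_diffs b) u w x * M w v).
Proof.
move=> bk.
(* Since (k+1)/(k+1)! = 1/k!, differentiating only multiplies the constant by [K]; the bound thus
   also covers the second derived series, which termwise differentiation requires. *)
have dbound (f : R^nat) L : (forall k, `|f k| <= L * K ^+ k / k`!%:R) ->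
    forall k, `|pseries_diffs f k| <= (L * K) * K ^+ k / k`!%:R.
  move=> fL k; rewrite /pseries_diffs normrM normr_nat.
  rewrite (le_trans (ler_wpM2l _ (fL _))) // exprS factS natrM invfM.
  by rewrite mulrCA mulVKf ?pnatr_eq0 // !mulrA.
have f0 k : `|b k * (M ^+ k) u v| <= 1 * K ^+ k / k`!%:R.
  by rewrite normrM mul1r mulrC ler_pM // exprmx_entry_le.
have db k : `|pseries_diffs b k| <= k`!%:R^-1.
  rewrite /pseries_diffs normrM normr_nat (le_trans (ler_wpM2l _ (bk _))) //.
  by rewrite factS natrM invfM mulVKf // pnatr_eq0.
have -> : \sum_w mxseries (pseries_diffs b) u w x * M w v =
    limn (pseries (pseries_diffs (fun k => b k * (M ^+ k) u v)) x).
  have -> : pseries_diffs (fun k => b k * (M ^+ k) u v) =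
     (fun k => \sum_w (pseries_diffs b k * (M ^+ k) u w) * M w v).
    apply/funext => k; rewrite /pseries_diffs exprSr mxE mulrA mulr_sumr.
    by apply: eq_bigr => w _; rewrite !mulrA.
  apply/esym/cvg_lim => //.
  have -> : pseries (fun k => \sum_w (pseries_diffs b k * (M ^+ k) u w) * M w v) x =
     (fun n => \sum_w pseries (fun k => pseries_diffs b k * (M ^+ k) u w) x n * M w v).
    apply/funext => n; rewrite /pseries /series /=.
    under eq_bigr do rewrite mulr_suml.
    rewrite exchange_big; apply: eq_bigr => w _ /=.
    by rewrite mulr_suml; apply: eq_bigr => k _; rewrite mulrAC.
  apply: cvg_big => [|w _]; first exact: add_continuous; apply: cvgMr_tmp.
  exact: is_cvg_mxseries.
apply: (@pseries_snd_diffs _ _ (`|x| + 1)).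
- exact: is_cvg_mxseries.
- by apply: is_cvg_pseries_expn_bound (dbound _ _ f0); rewrite // mul1r.
- apply: is_cvg_pseries_expn_bound (dbound _ _ (dbound _ _ f0)) => //.
  by rewrite mul1r mulr_ge0.
- by rewrite [ltRHS]ger0_norm ?addr_ge0 // ltrDl.
Qed.

End MatrixSeries.

(** * Entries of cos(tM) and sin(tM), unitarity, and the nonsingular case *)

Section Transition.
Variables (R : realType) (N : nat) (M : 'M[R]_N).

(** Taylor coefficients in all degrees, zero at the wrong parity, in the form that [diffs_cos] and
    [diffs_sin] relate. *)
Let cosc (k : nat) : R := (~~ odd k)%:R * (-1) ^+ k./2 * k`!%:R^-1.
Let sinc (k : nat) : R := (odd k)%:R * (-1) ^+ k.-1./2 * k`!%:R^-1.

Let cosc_le k : `|cosc k| <= k`!%:R^-1.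
Proof.
rewrite /cosc !normrM normfV normrX normrN normr1 expr1n mulr1 !normr_nat.
by case: odd; rewrite ?mul0r ?mul1r.
Qed.

Let sinc_le k : `|sinc k| <= k`!%:R^-1.
Proof.
rewrite /sinc !normrM normfV normrX normrN normr1 expr1n mulr1 !normr_nat.
by case: odd; rewrite ?mul0r ?mul1r.
Qed.

(** Grouping the convergent full series into pairs of degrees 2k, 2k+1 keeps its limit, and the odd
    term of each pair is 0. *)
Lemma Ure_mxseries t u v : Ure M t u v = mxseries M cosc u v t.
Proof.
have /(@cvg_series_cvg_series_group _ _ 2)/(_ isT) :=
  @is_cvg_mxseries R N M _ u v t cosc_le.
rewrite -[limn _]/(mxseries M cosc u v t) => h.
apply/cvg_lim => //; apply: cvg_trans h.
rewrite [X in series X](_ : _ = (fun k => \sum_(k * 2 <= i < k.+1 * 2)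
   cosc i * (M ^+ i) u v * t ^+ i)) //.
apply/funext => k; rewrite mulSn addnC addn2 big_ltn // big_nat1 /cosc /= muln2.
rewrite odd_double /= doubleK mul1r !mul0r addr0 mul2n.
by rewrite [RHS]mulrAC; congr (_ * _); rewrite mulrAC.
Qed.

Lemma Uim_mxseries t u v : Uim M t u v = mxseries M sinc u v t.
Proof.
have /(@cvg_series_cvg_series_group _ _ 2)/(_ isT) :=
  @is_cvg_mxseries R N M _ u v t sinc_le.
rewrite -[limn _]/(mxseries M sinc u v t) => h.
apply/cvg_lim => //; apply: cvg_trans h.
rewrite [X in series X](_ : _ = (fun k => \sum_(k * 2 <= i < k.+1 * 2)
   sinc i * (M ^+ i) u v * t ^+ i)) //.
apply/funext => k; rewrite mulSn addnC addn2 big_ltn // big_nat1 /sinc /= muln2.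
rewrite odd_double /= doubleK mul1r !mul0r add0r mul2n addn1.
by rewrite [RHS]mulrAC; congr (_ * _); rewrite mulrAC.
Qed.

Lemma is_derive_Uim u v (t : R) :
  is_derive t (1 : R) (fun t => Uim M t u v) (\sum_w Ure M t u w * M w v).
Proof.
have -> : (fun t => Uim M t u v) = mxseries M sinc u v.
  by apply/funext => x; exact: Uim_mxseries.
under eq_bigr do rewrite Ure_mxseries.
by have := @is_derive_mxseries R N M sinc u v t sinc_le; rewrite diffs_sin.
Qed.

Lemma is_derive_Ure u v (t : R) :
  is_derive t (1 : R) (fun t => Ure M t u v) (- \sum_w Uim M t u w * M w v).
Proof.
have -> : (fun t => Ure M t u v) = mxseries M cosc u v.
  by apply/funext => x; exact: Ure_mxseries.
have -> : - (\sum_w Uim M t u w * M w v) =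
    \sum_w mxseries M (pseries_diffs cosc) u w t * M w v.
  rewrite -sumrN; apply: eq_bigr => w _; rewrite -mulNr; congr (_ * _).
  rewrite Uim_mxseries diffs_cos /mxseries.
  have c := @is_cvg_mxseries R N M _ u w t sinc_le.
  rewrite -limN //; congr (limn _); apply/funext => n.
  rewrite [LHS](_ : _ = - \sum_(0 <= k < n) sinc k * (M ^+ k) u w * t ^+ k) //.
  rewrite -sumrN; apply: eq_bigr => k _.
  by rewrite /= !mulNr.
exact: is_derive_mxseries.
Qed.

Lemma Ure0 u v : Ure M 0 u v = (u == v)%:R.
Proof.
apply: lim_near_cst => //; near=> m; rewrite -[m]prednK; last by near: m.
rewrite /series /= big_nat_recl //= big1 ?addr0.
  by rewrite muln0 !expr0 fact0 divr1 !mul1r mxE.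
by move=> i _; rewrite mulnS expr0n !(mulr0, mul0r).
Unshelve. all: by end_near. Qed.

Lemma Uim0 u v : Uim M 0 u v = 0.
Proof.
apply: lim_near_cst => //; near=> m.
rewrite /series /= big1 // => i _.
by rewrite addn1 expr0n !(mulr0, mul0r).
Unshelve. all: by end_near. Qed.

Lemma Uim_eq0 u v t : (forall k, (M ^+ (2 * k + 1)) u v = 0) -> Uim M t u v = 0.
Proof.
move=> h; apply: lim_near_cst => //; near=> m.
by rewrite /series /= big1 // => i _; rewrite h mulr0.
Unshelve. all: by end_near. Qed.

(* Unitarity of U(t): the derivative of the sum vanishes by symmetry of M. *)
Lemma sum_sqr_Ure_Uim u t : M^T = M ->
  \sum_v (Ure M t u v ^+ 2 + Uim M t u v ^+ 2) = 1.
Proof.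
move=> Msym.
pose E t := \sum_v (Ure M t u v ^+ 2 + Uim M t u v ^+ 2).
have -> : \sum_v (Ure M t u v ^+ 2 + Uim M t u v ^+ 2) = E 0.
  rewrite -/(E t); apply: is_derive_0_is_cst => x.
  have -> : E = \sum_v ((fun t => Ure M t u v) ^+ 2 + (fun t => Uim M t u v) ^+ 2).
    by apply/funext => y; rewrite /E fct_sumE.
  apply: is_derive_eq.
    apply: is_derive_sum => v; apply: is_deriveD; apply: is_deriveX.
      exact: is_derive_Ure.
    exact: is_derive_Uim.
  rewrite /= big_split /=.
  under eq_bigr do rewrite expr1 /GRing.scale /= mulrN mulr_sumr.
  under [X in _ + X]eq_bigr do rewrite expr1 /GRing.scale /= mulr_sumr.
  rewrite sumrN [X in _ + X]exchange_big /= addrC; apply/eqP; rewrite subr_eq0; apply/eqP.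
  apply: eq_bigr => v _; apply: eq_bigr => w _.
  have -> : M v w = M w v by rewrite -[in LHS]Msym mxE.
  by rewrite -!mulrA; congr (_ * _); rewrite mulrCA.
rewrite /E (bigD1 u) //= Ure0 Uim0 eqxx expr1n expr0n addr0 big1 ?addr0 // => v vu.
by rewrite Ure0 Uim0 eq_sym (negbTE vu) expr0n addr0.
Qed.

Lemma Uim_norm_le1 u v t : M^T = M -> `|Uim M t u v| <= 1.
Proof.
move=> Msym; rewrite -(@expr_le1 _ 2) // -normrX ger0_norm ?sqr_ge0 //.
rewrite -(sum_sqr_Ure_Uim u t Msym) (bigD1 v) //= addrAC lerDr addr_ge0 ?sqr_ge0 //.
by apply: sumr_ge0 => w _; rewrite addr_ge0 ?sqr_ge0.
Qed.

Lemma not_sedentary_nonsingular u : M^T = M -> M \in unitmx ->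
  (forall k, (M ^+ (2 * k + 1)) u u = 0) -> not_sedentary M u.
Proof.
move=> Msym Munit odd0 e e0.
apply: contrapT => /forallNP sed.
have bnd t : 0 < t -> e <= `|Ure M t u u|.
  move=> t0; have /not_andP[//|/negP] := sed t.
  by rewrite -leNgt /Uabs Uim_eq0 // expr0n addr0 sqrtr_sqr.
have cont : continuous (fun t => Ure M t u u).
  move=> x; apply/differentiable_continuous/derivable1_diffP.
  by have [] := is_derive_Ure u u x.
(* A value at most -e would, with the value 1 at time 0, force a zero at some c > 0, against
   [bnd]. *)
have pos t : 0 < t -> e <= Ure M t u u.
  move=> t0; have := bnd _ t0; rewrite ler_normr => /orP[//|le].
  have [|||c] := @IVT R (fun t => Ure M t u u) 0 t 0.
  - exact: ltW.
  - exact: continuous_subspaceT.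
  - rewrite Ure0 eqxx ge_min le_max ler01 /= andbT.
    by rewrite -(oppr_ge0 (Ure M t u u)) (le_trans (ltW e0) le) orbT.
  rewrite in_itv /= => /andP[c0 ct] Uc.
  have [ceq0|cn0] := eqVneq c 0.
    by move: Uc; rewrite ceq0 Ure0 eqxx => /eqP; rewrite oner_eq0.
  have := bnd c; rewrite lt_def cn0 c0 => /(_ isT).
  by rewrite Uc normr0 leNgt e0.
(* The bounded primitive: the entry (u, u) of sin(tM) M^-1. *)
pose g t := \sum_w Uim M t u w * invmx M w u.
have dg (t : R) : is_derive t (1 : R) g (Ure M t u u).
  have -> : g = \sum_w (invmx M w u \*: (fun t => Uim M t u w)).
    by apply/funext => y; rewrite /g fct_sumE; apply: eq_bigr => w _; rewrite mulrC.
  apply: is_derive_eq.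
    by apply: is_derive_sum => w; apply: is_deriveZ; exact: is_derive_Uim.
  transitivity (\sum_z Ure M t u z * (M *m invmx M) z u).
    under eq_bigr do rewrite /GRing.scale /= mulr_sumr.
    rewrite exchange_big; apply: eq_bigr => z _ /=.
    rewrite mxE mulr_sumr; apply: eq_bigr => w _.
    by rewrite mulrC -mulrA.
  rewrite mulmxV // (bigD1 u) //= mxE eqxx mulr1 big1 ?addr0 // => z zu.
  by rewrite mxE (negbTE zu) mulr0.
pose B := \sum_w `|invmx M w u|.
have gB t : `|g t| <= B.
  rewrite (le_trans (ler_norm_sum _ _ _)) // ler_sum // => w _.
  by rewrite normrM ler_piMl // Uim_norm_le1.
have B0 : 0 <= B by apply: sumr_ge0.
(* Chosen so that e T = B + 1 exceeds the bound [B] on g, while the mean value theorem gives g(T) >=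
   e T. *)
pose T := (B + 1) / e.
have T0 : 0 < T by rewrite divr_gt0 // ltr_wpDl.
have g0 : g 0 = 0 by rewrite /g big1 // => w _; rewrite Uim0 mul0r.
have [|c] := @MVT R g (fun t => Ure M t u u) 0 T T0 (fun x _ => dg x).
  apply: continuous_subspaceT => x; apply/differentiable_continuous/derivable1_diffP.
  by have [] := dg x.
rewrite in_itv /= g0 !subr0 => /andP[c0 _] gT.
have := le_trans (ler_norm _) (gB T).
rewrite gT leNgt => /negP; apply.
apply: (@lt_le_trans _ _ (e * T)).
  by rewrite /T mulrCA divff ?gt_eqF // mulr1 ltrDl.
by rewrite ler_pM2r // pos.
Qed.

End Transition.

(** * Incidence matrices of unicyclic graphs *)

(* A repetition of minimal gap in an infinite non-backtracking walk is a cycle. *)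
Lemma nonbacktracking_cycle (T : finType) (e : rel T) (x0 y0 : T) :
  irreflexive e -> e x0 y0 ->
  (forall x y, e x y -> exists2 z, e y z & z != x) ->
  exists p (c : 'I_p -> T), [/\ (3 <= p)%N, injective c &
    forall i, e (c i) (c (ordS i))].
Proof.
move=> eirr e0 step.
(* The state of the walk is its current directed edge. The default [a.1] would backtrack; [step]
   rules it out along the walk. *)
pose nxt (a : T * T) : T * T :=
  (a.2, if pselect (exists z, e a.2 z && (z != a.1)) is left h
        then xchoose h else a.1).
pose walk k := iter k nxt (x0, y0).
pose w k := (walk k).1.
have walkP k : e (walk k).1 (walk k).2.
  elim: k => //= k IH.
  case: pselect => [h|[]] /=; first by have /andP[] := xchooseP h.
  by have [z ez zx] := step _ _ IH; exists z; apply/andP.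
have wS k : w k.+1 = (walk k).2 by [].
have ew k : e (w k) (w k.+1) by exact: walkP.
have nb k : w k.+2 != w k.
  rewrite wS /= /w.
  case: pselect => [h|[]] /=; first by have /andP[] := xchooseP h.
  by have [z ez zx] := step _ _ (walkP k); exists z; apply/andP.
have rep : exists d, (0 < d)%N && `[< exists i, w i = w (i + d)%N >].
  have : ~~ injectiveb (fun i : 'I_#|T|.+1 => w i).
    by apply/negP => /injectiveP/leq_card; rewrite card_ord ltnn.
  case/injectivePn => i [j ij wij].
  wlog lij : i j ij wij / (i < j)%N.
    move=> W; case: (ltngtP i j) => [|ji|/val_inj ijE]; first exact: W.
      by apply: (W j i) => //; rewrite eq_sym.
    by rewrite ijE eqxx in ij.
  exists (j - i)%N; rewrite subn_gt0 lij /=; apply/asboolP; exists i.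
  by rewrite subnKC // ltnW.
case: (ex_minnP rep) => d /andP[d0 /asboolP[i wi]] dmin.
(* Gap 1 would be a loop and gap 2 a backtracking step. *)
have d3 : (3 <= d)%N.
  case: d d0 wi {dmin} => [|[|[|d]]] // _; last 1 first.
  - by rewrite addn2 => wi; have := nb i; rewrite wi eqxx.
  - by rewrite addn1 => wi; have := ew i; rewrite -wi eirr.
exists d, (fun k : 'I_d => w (i + k)%N); split=> //.
  move=> j k; wlog ljk : j k / (j < k)%N.
    move=> W wjk; case: (ltngtP j k) => [jk|kj|/val_inj//]; first exact: W.
    by apply/esym/W.
  move=> wjk; have : (d <= k - j)%N.
    apply: dmin; rewrite subn_gt0 ljk; apply/asboolP; exists (i + j)%N.
    by rewrite -addnA subnKC // ltnW.
  by rewrite leqNgt ltn_subLR ?(ltnW ljk) // (leq_trans (ltn_ord k)) ?leq_addl.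
move=> j /=.
(* At the last index [ordS] wraps to 0, and w (i + d) = w i closes the cycle. *)
have [jd|] := ltnP j.+1 d; first by rewrite modn_small // addnS.
move=> jd; have jE : j.+1 = d by apply/eqP; rewrite eqn_leq jd andbT ltn_ord.
have -> : (j.+1 %% d = 0)%N by rewrite jE modnn.
have dE : (i + d)%N = (i + j).+1 by rewrite -addnS jE.
by rewrite addn0 wi dE.
Qed.

Section Graph.
Variables (R : realType) (n : nat) (A : 'M[R]_n).

Lemma enum_edgeP (k : 'I_(nedges A)) :
  let e := enum_val k in (e.1 < e.2)%N /\ A e.1 e.2 != 0.
Proof. by apply/andP; exact: (enum_valP k). Qed.

Lemma edge_index (i j : 'I_n) : simple_weighted A -> A i j != 0 ->
  exists k : 'I_(nedges A), enum_val k = (i, j) \/ enum_val k = (j, i).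
Proof.
move=> [sA dA] Aij.
have Aji : A j i != 0 by rewrite -sA mxE.
have [ij|ji|/val_inj ijE] := ltngtP i j.
- have h : (i, j) \in edge_pred A by apply/andP.
  by exists (enum_rank_in h (i, j)); left; rewrite enum_rankK_in.
- have h : (j, i) \in edge_pred A by apply/andP.
  by exists (enum_rank_in h (j, i)); right; rewrite enum_rankK_in.
- by rewrite ijE dA eqxx in Aij.
Qed.

Lemma edge_index_inj (k l : 'I_(nedges A)) i j :
  (enum_val k = (i, j) \/ enum_val k = (j, i)) ->
  (enum_val l = (i, j) \/ enum_val l = (j, i)) -> k = l.
Proof.
have [kl _] := enum_edgeP k; have [ll _] := enum_edgeP l.
move=> [ke|ke] [le|le]; apply: enum_val_inj; rewrite ke le //.
  by move: kl ll; rewrite ke le /= => /ltn_trans h /h; rewrite ltnn.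
by move: kl ll; rewrite ke le /= => /ltn_trans h /h; rewrite ltnn.
Qed.

Lemma mulmx_winc (x : 'rV[R]_n) (k : 'I_(nedges A)) :
  (x *m winc A) 0 k =
  let e := enum_val k in (x 0 e.1 + x 0 e.2) * A e.1 e.2.
Proof.
have [/= lt12 _] := enum_edgeP k.
have ne : (enum_val k).2 != (enum_val k).1 by rewrite -(inj_eq val_inj) gtn_eqF.
rewrite mxE (bigD1 (enum_val k).1) //= (bigD1 (enum_val k).2) //= !mxE /= !eqxx orbT.
rewrite big1 ?addr0 ?mulrDl // => v /andP[v1 v2].
by rewrite mxE /= (negbTE v1) (negbTE v2) mulr0.
Qed.

Lemma mulmx_winc_eq0 (x : 'rV[R]_n) : simple_weighted A ->
  x *m winc A = 0 <-> (forall i j, A i j != 0 -> x 0 i + x 0 j = 0).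
Proof.
move=> sA; split=> [xB i j Aij|xij].
  have [k ek] := edge_index sA Aij.
  have [/= _ Ak] := enum_edgeP k.
  have /eqP := congr1 (fun y : 'rV_ _ => y 0 k) xB.
  rewrite mulmx_winc mxE mulf_eq0 (negbTE Ak) orbF => /eqP.
  by case: ek => -> //=; rewrite addrC.
apply/rowP => k; rewrite mulmx_winc mxE /=.
by have [/= _ Ak] := enum_edgeP k; rewrite xij // mul0r.
Qed.

(** The oriented incidence matrix of the underlying unweighted graph; the kernel of y -> y D^T is
    the cycle space. It serves to count edges. *)
Definition signed_incidence : 'M[R]_(n, nedges A) :=
  \matrix_(v, k) ((v == (enum_val k).1)%:R - (v == (enum_val k).2)%:R).

(* No vertex is met by exactly one edge of the support of a kernel vector y, so
   this support contains a cycle, hence the only cycle of X, hence the edge k0. *)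
Lemma signed_incidence_kernel (y : 'rV[R]_(nedges A)) (k0 : 'I_(nedges A)) :
  simple_weighted A -> unicyclic A ->
  (exists p (c : 'I_p -> 'I_n), is_cycle A c /\
    [set (enum_val k0).1; (enum_val k0).2] \in cycle_edges c) ->
  y *m signed_incidence^T = 0 -> y 0 k0 = 0 -> y = 0.
Proof.
move=> [sA dA] [_ [q [d [_ uniq]]]] [p [c [cyc k0c]]] yD yk0.
apply: contrapT => /eqP y0.
(* Adjacency in the subgraph formed by the support of [y]. *)
pose e : rel 'I_n := fun v w => [exists k, (y 0 k != 0) &&
  ((enum_val k == (v, w)) || (enum_val k == (w, v)))].
have eP v w : e v w -> exists2 k, y 0 k != 0 & enum_val k = (v, w) \/ enum_val k = (w, v).
  by move=> /existsP[k /andP[yk /orP[]/eqP ek]]; exists k => //; [left|right].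
have eI k v w : y 0 k != 0 -> enum_val k = (v, w) \/ enum_val k = (w, v) -> e v w.
  move=> yk ek; apply/existsP; exists k; rewrite yk /=.
  by case: ek => ->; rewrite eqxx ?orbT.
have eA v w : e v w -> A v w != 0.
  move=> /eP[k _ ek]; have [/= _] := enum_edgeP k.
  by case: ek => -> //=; rewrite -[in A w v]sA mxE.
have eirr : irreflexive e.
  by move=> v; apply/negbTE/negP => /eA; rewrite dA eqxx.
have [k1 yk1] : exists k, y 0 k != 0.
  apply: contrapT => /forallNP h; move/eqP: y0; apply; apply/rowP => k.
  by rewrite mxE; apply/eqP; apply/negPn/negP/h.
(* The kernel equation at w has a nonzero term from the edge vw, so another support edge meets w;
   its other end is not v, as edges are not repeated. *)
have step v w : e v w -> exists2 z, e w z & z != v.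
  move=> /eP[k yk ek].
  have /eqP := congr1 (fun z : 'rV_ _ => z 0 w) yD.
  rewrite !mxE (bigD1 k) //= !mxE => sum0.
  have vw : v != w.
    have [/= lt _] := enum_edgeP k.
    by apply/negP => /eqP vw; move: lt; case: ek => -> /=; rewrite vw ltnn.
  have Dk : y 0 k * ((w == (enum_val k).1)%:R - (w == (enum_val k).2)%:R) != 0.
    rewrite mulf_neq0 //; case: ek => -> /=; rewrite eqxx (eq_sym w) (negbTE vw).
      by rewrite sub0r oppr_eq0 oner_eq0.
    by rewrite subr0 oner_eq0.
  have [l lk yl] : exists2 l, l != k &
      y 0 l * ((w == (enum_val l).1)%:R - (w == (enum_val l).2)%:R) != 0.
    apply: contrapT => h; move: sum0; rewrite big1 ?addr0 ?(negbTE Dk) // => l lk.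
    by rewrite !mxE; apply/eqP/negPn/negP => yl; apply: h; exists l.
  move: yl; rewrite mulf_eq0 negb_or => /andP[yl].
  case El : (enum_val l) => [a b] /=.
  have [wa|wa] := eqVneq w a.
    move=> _; exists b; first by apply: (eI l) => //; left; rewrite El wa.
    apply: contraNneq lk => bv; apply/eqP/edge_index_inj; last exact: ek.
    by right; rewrite El wa bv.
  have [wb|wb] := eqVneq w b; last by rewrite subrr eqxx.
  move=> _; exists a; first by apply: (eI l) => //; right; rewrite El wb.
  apply: contraNneq lk => av; apply/eqP/edge_index_inj; last exact: ek.
  by left; rewrite El wb av.
have e1 : e (enum_val k1).1 (enum_val k1).2.
  by apply: (eI k1) => //; left; case: (enum_val k1).
have [p' [c' [p3 c'inj c'e]]] := nonbacktracking_cycle eirr e1 step.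
have cyc' : is_cycle A c' by split=> //; split=> // i; exact/eA.
(* By uniqueness [k0] is an edge of the cycle found in the support, contradicting [yk0]. *)
move: k0c; rewrite (uniq _ _ cyc) -(uniq _ _ cyc') => /imsetP[i _ ie].
have /eP[k yk ek] := c'e i.
suff kk0 : k = k0 by rewrite kk0 yk0 eqxx in yk.
apply: edge_index_inj ek _.
have [/= lt0 _] := enum_edgeP k0.
move: ie lt0; case: (enum_val k0) => a b /= ie lt0.
have : a \in [set c' i; c' (ordS i)] by rewrite -ie !inE eqxx.
have : b \in [set c' i; c' (ordS i)] by rewrite -ie !inE eqxx orbT.
rewrite !inE => /orP[]/eqP bE /orP[]/eqP aE; move: lt0; rewrite ?aE ?bE ?ltnn //.
  by right.
by left.
Qed.

(* G is row-free by the previous lemma, but its n + 1 columns are dependent since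
   each column of the signed incidence matrix sums to 0. *)
Lemma unicyclic_nedges_le : simple_weighted A -> unicyclic A -> (nedges A <= n)%N.
Proof.
move=> sA uA; have [_ [p [c [cyc _]]]] := uA.
have [p3 [cinj ce]] := cyc.
pose i0 : 'I_p := Ordinal (ltnW (ltnW p3)).
have [k0 ek0] := edge_index sA (ce i0).
have k0c : [set (enum_val k0).1; (enum_val k0).2] \in cycle_edges c.
  by apply/imsetP; exists i0 => //; case: ek0 => -> //=; rewrite finset.setUC.
(* The extra column turns the condition y k0 = 0 into a kernel equation. *)
pose G := row_mx signed_incidence^T (delta_mx k0 (0 : 'I_1)).
have Gfree : row_free G.
  apply/inj_row_free => y; rewrite mul_mx_row => /eqP.
  rewrite row_mx_eq0 => /andP[/eqP yD /eqP yk].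
  apply: (@signed_incidence_kernel y k0) => //; first by exists p, c.
  have := congr1 (fun M : 'M[R]_1 => M 0 0) yk.
  rewrite !mxE (bigD1 k0) //= mxE !eqxx mulr1 big1 ?addr0 // => k kk0.
  by rewrite mxE (negbTE kk0) mulr0.
have G1 : G *m col_mx (const_mx 1 : 'cV_n) 0 = 0.
  rewrite mul_row_col mulmx0 addr0; apply/matrixP => k j; rewrite !mxE.
  under eq_bigr do rewrite !mxE mulr1.
  rewrite sumrB.
  have one (a : 'I_n) : \sum_(i < n) (i == a)%:R = 1 :> R.
    by rewrite (bigD1 a) //= eqxx big1 ?addr0 // => i /negbTE ->.
  by rewrite !one subrr.
have n0 : (0 < n)%N by case: (n) (c i0) => // -[].
have col1 : \rank (col_mx (const_mx 1 : 'cV[R]_n) (0 : 'cV_1)) = 1%N.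
  apply/eqP; rewrite eqn_leq rank_leq_col /= lt0n mxrank_eq0.
  apply/eqP => /matrixP/(_ (lshift 1 (Ordinal n0)) 0).
  by rewrite col_mxEu !mxE => /eqP; rewrite oner_eq0.
(* The ranks satisfy [nedges A] + 1 <= n + 1. *)
have := mulmx0_rank_max G1.
by rewrite (eqP Gfree) col1 leq_add2r.
Qed.

(** The incidence matrix has rank n by [inj], and [nedges A] <= n makes its columns independent too,
    so both off-diagonal blocks act injectively. *)
Lemma subdiv_unitmx : simple_weighted A -> unicyclic A ->
  (forall x : 'rV[R]_n, (forall i j, A i j != 0 -> x 0 i + x 0 j = 0) -> x = 0) ->
  subdiv A \in unitmx.
Proof.
move=> sA uA inj.
have Bfree : row_free (winc A).
  by apply/inj_row_free => x /(mulmx_winc_eq0 _ sA)/inj.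
have Bfull : row_full (winc A).
  by rewrite /row_full eqn_leq rank_leq_col (eqP Bfree) unicyclic_nedges_le.
rewrite -row_free_unit; apply/inj_row_free => z.
rewrite -[z]hsubmxK /subdiv mul_row_block !mulmx0 add0r addr0 => /eqP.
rewrite row_mx_eq0 => /andP[/eqP yB /eqP xB].
have -> : lsubmx z = 0 by apply: (row_free_inj Bfree); rewrite xB mul0mx.
have Btfree : row_free (winc A)^T by rewrite /row_free mxrank_tr.
have -> : rsubmx z = 0 by apply: (row_free_inj Btfree); rewrite yB mul0mx.
exact: row_mx0.
Qed.

Lemma subdiv_sym : (subdiv A)^T = subdiv A.
Proof. by rewrite /subdiv tr_block_mx !trmx0 trmxK. Qed.

(** Even powers are block diagonal, so odd powers are block antidiagonal: a bipartite graph has no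
    closed walk of odd length. *)
Lemma subdiv_odd_diag k u : (subdiv A ^+ (2 * k + 1)) u u = 0.
Proof.
have even : exists P Q, subdiv A ^+ (2 * k) = block_mx P 0 0 Q.
  elim: k => [|k [P [Q IH]]].
    by rewrite muln0 expr0; exists 1%:M, 1%:M; rewrite -scalar_mx_block.
  rewrite mulnS exprD IH expr2 -!mulmxE /subdiv !mulmx_block.
  rewrite !(mul0mx, mulmx0, add0r, addr0).
  by do 2!eexists.
have [P [Q PQ]] := even.
rewrite exprD PQ expr1 -mulmxE /subdiv mulmx_block !(mul0mx, mulmx0, add0r, addr0).
case: (splitP u) => j uj.
  by rewrite (_ : u = lshift _ j) ?block_mxEul ?mxE //; exact: val_inj.
by rewrite (_ : u = rshift _ j) ?block_mxEdr ?mxE //; exact: val_inj.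
Qed.

Lemma connected_edge_sum0 (x : 'rV[R]_n) : connected_graph A ->
  (forall i j, A i j != 0 -> x 0 i + x 0 j = 0) ->
  forall i j, `|x 0 i| = `|x 0 j|.
Proof.
move=> con xA i j; have /connectP[s sp ->] := con i j.
elim: s i sp => //= k s IH i /andP[/xA /eqP].
by rewrite addr_eq0 => /eqP -> /IH <-; rewrite normrN.
Qed.

End Graph.

(** * Trivial kernel in the two cases of the theorem *)

Lemma nonbipartite_edge_sum0 (R : realType) n (A : 'M[R]_n) (x : 'rV[R]_n) :
  connected_graph A -> ~ bipartite A ->
  (forall i j, A i j != 0 -> x 0 i + x 0 j = 0) -> x = 0.
Proof.
move=> con nbip xA; apply/rowP => i; rewrite mxE.
(* A nonzero x vanishes nowhere and flips sign along edges, so its sign is a 2-colouring. *)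
apply: contrapT => /eqP xi; apply: nbip; exists (fun j => 0 < x 0 j) => j k Ajk.
have xj : x 0 j != 0 by rewrite -normr_eq0 (connected_edge_sum0 con xA j i) normr_eq0.
move/eqP: (xA _ _ Ajk); rewrite addrC addr_eq0 => /eqP ->.
by rewrite oppr_gt0; case: ltgtP xj.
Qed.

Lemma cycle_edge_sum0 (R : realType) n p (A : 'M[R]_n) (c : 'I_p -> 'I_n) (x : 'rV[R]_n) :
  simple_weighted A -> connected_graph A -> is_cycle A c ->
  subdiv (cycle_mx A c) \in unitmx ->
  (forall i j, A i j != 0 -> x 0 i + x 0 j = 0) -> x = 0.
Proof.
move=> [sA dA] con [p3 _] unit xA.
have sC : simple_weighted (cycle_mx A c).
  split; last by move=> i; rewrite mxE dA if_same.
  by apply/matrixP => i j; rewrite !mxE orbC -[in A (c j) _]sA mxE.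
pose y : 'rV[R]_p := \row_i x 0 (c i).
(* The restriction of x to the cycle, padded by 0 on the new vertices, lies in the left kernel of
   the nonsingular S(C_p). *)
have y0 : row_mx y 0 = 0 :> 'rV[R]_(p + nedges (cycle_mx A c)).
  apply: (can_inj (mulmxK unit)); rewrite mul0mx /subdiv mul_row_block.
  rewrite !(mulmx0, mul0mx, addr0) (proj2 (mulmx_winc_eq0 y sC)) ?row_mx0 //.
  move=> i j; rewrite !mxE; case: ifP => _; last by rewrite eqxx.
  exact: xA.
pose i0 : 'I_p := Ordinal (ltnW (ltnW p3)).
have xc : x 0 (c i0) = 0.
  move/eqP: y0; rewrite row_mx_eq0 => /andP[/eqP/rowP/(_ i0)].
  by rewrite !mxE.
apply/rowP => i; rewrite mxE; apply/eqP.
by rewrite -normr_eq0 (connected_edge_sum0 con xA i (c i0)) xc normr0.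
Qed.

Theorem theorem36 (R : realType) :
  (forall (n : nat) (A : 'M[R]_n),
      simple_weighted A -> unicyclic A ->
      forall (p : nat) (c : 'I_p -> 'I_n),
        is_cycle A c ->
        subdiv (cycle_mx A c) \in unitmx ->
        forall u : 'I_(n + nedges A), not_sedentary (subdiv A) u)
  /\
  (forall (n : nat) (A : 'M[R]_n),
      simple_weighted A -> unweighted A -> unicyclic A -> ~ bipartite A ->
      forall u : 'I_(n + nedges A), not_sedentary (subdiv A) u).
Proof.
split=> [n A sA uA p c cyc Cunit u|n A sA _ uA nbip u];
  (apply: not_sedentary_nonsingular => [||k];
    [exact: subdiv_sym| |exact: subdiv_odd_diag]); apply: subdiv_unitmx => // x xA.
  exact: cycle_edge_sum0 (proj1 uA) cyc Cunit xA.
exact: nonbipartite_edge_sum0 (proj1 uA) nbip xA.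
Qed.
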